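(* Let $\mathcal{A}$ be a unital associative complex algebra with identity $\mathbf{1}$, and let $a, b$ be two arbitrary elements of $\mathcal{A}$. Then: (i) for any integer $n \geq 1$, $$a^{n} - b^{n} = \sum_{k=0}^{n-1} \sum_{j=0}^{n-k} \binom{n}{k} \binom{n-k}{j} (-1)^{j} a^{n-k-j} b^{j+k};$$ (ii) for any $c \in \mathcal{A}$ and any non-negative integer $n$, $$(a+b)^n = \sum_{k=0}^{n} \binom{n}{k}\, \delta_{a+b,c}^{\,n-k}(\mathbf{1})\, c^{k} = \sum_{k=0}^{n} \sum_{j=0}^{n-k} \binom{n}{k} \binom{n-k}{j} (-1)^{j} (a+b)^{n-k-j} c^{j+k}.$$
   Context: For $b_1, b_2 \in \mathcal{A}$, the linear map $\delta_{b_1,b_2} : \mathcal{A} \to \mathcal{A}$ is defined by $\delta_{b_1,b_2}(x) = b_1 x - x b_2$ for $x \in \mathcal{A}$ (an inner generalized derivation). $\delta_{b_1,b_2}^{\,m}$ denotes the $m$-fold composition of $\delta_{b_1,b_2}$ with itself, with $\delta_{b_1,b_2}^{\,0}$ the identity map. For $x\in\mathcal{A}$, $x^0 = \mathbf{1}$. The algebra is not assumed commutative. *)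

(* Defs.v *)
From HB Require Import structures.
From mathcomp Require Import all_boot all_order all_algebra.
From mathcomp Require Import reals complex.

Set Implicit Arguments.
Unset Strict Implicit.
Unset Printing Implicit Defensive.

Import GRing.Theory.
Local Open Scope ring_scope.

(* [algType K] imposes [1 != 0], which excludes the zero algebra; [pzAlgType K]
   is a unital associative algebra without that axiom. It cannot be declared as
   a join of [GRing.PzRing] and [GRing.Lmodule] (the library hierarchy has no
   such join below [lalgType]), so it carries its own scaling, from which the
   [lmodType K] structure, hence [*:], is derived. *)
HB.mixin Record PzRing_isPzAlgebra (K : pzRingType) (A : Type)
    of GRing.PzRing A := {
  pz_scale : K -> A -> A;
  pz_scaleA : forall (y z : K) (u : A),
    pz_scale y (pz_scale z u) = pz_scale (y * z) u;
  pz_scale1 : forall u : A, pz_scale 1 u = u;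
  pz_scaleDr : forall (z : K) (u v : A),
    pz_scale z (u + v) = pz_scale z u + pz_scale z v;
  pz_scaleDl : forall (u : A) (y z : K),
    pz_scale (y + z) u = pz_scale y u + pz_scale z u;
  pz_scaleAl : forall (z : K) (u v : A),
    pz_scale z (u * v) = pz_scale z u * v;
  pz_scaleAr : forall (z : K) (u v : A),
    pz_scale z (u * v) = u * pz_scale z v
}.

#[short(type="pzAlgType")]
HB.structure Definition PzAlgebra (K : pzRingType) :=
  {A of GRing.PzRing A & PzRing_isPzAlgebra K A}.

HB.instance Definition _ (K : pzRingType) (A : pzAlgType K) :=
  GRing.Zmodule_isLmodule.Build K (PzAlgebra.sort A)
    (@pz_scaleA K A) (@pz_scale1 K A) (@pz_scaleDr K A) (@pz_scaleDl K A).

Lemma pz_scalerAl (K : pzRingType) (A : pzAlgType K) (z : K) (u v : A) :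
  z *: (u * v) = (z *: u) * v.
Proof. exact: pz_scaleAl. Qed.

Lemma pz_scalerAr (K : pzRingType) (A : pzAlgType K) (z : K) (u v : A) :
  z *: (u * v) = u * (z *: v).
Proof. exact: pz_scaleAr. Qed.

Definition delta (K : pzRingType) (A : pzAlgType K) (b1 b2 x : A) : A :=
  b1 * x - x * b2.

Lemma delta_is_linear (K : pzRingType) (A : pzAlgType K) (b1 b2 : A) :
  linear (delta b1 b2).
Proof.
move=> z x y; rewrite /delta mulrDr mulrDl -pz_scalerAr -pz_scalerAl.
by rewrite scalerBr opprD addrACA.
Qed.

HB.instance Definition _ (K : pzRingType) (A : pzAlgType K) (b1 b2 : A) :=
  GRing.isLinear.Build K A A *:%R (delta b1 b2) (delta_is_linear b1 b2).

(* Main.v *)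
(** Left multiplication by [a] is the sum of the commuting additive maps
    [delta a c] and right multiplication by [c]; likewise [delta a c] is the sum
    of left multiplication by [a] and right multiplication by [- c].
    Both expansions are the binomial formula for commuting additive maps,
    evaluated at [1]. Part (i) is the formula of (ii) for [a ^+ n], whose
    [k = n] term is [b ^+ n]. *)
Require Import Defs.
From mathcomp Require Import all_boot all_order all_algebra.
From mathcomp Require Import reals complex.

Import GRing.Theory.
Local Open Scope ring_scope.

(** Induction on [n] by Pascal's rule, as for commuting ring elements; [fgC] lets the new [g] pass
    the iterates of [f]. *)
Lemma iter_additiveD (V : zmodType) (f g : {additive V -> V})
    (fgC : forall x, f (g x) = g (f x)) (n : nat) (x : V) :
  iter n (f \+ g) x =
    \sum_(0 <= k < n.+1) iter (n - k) f (iter k g x) *+ 'C(n, k).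
Proof.
have giterf m y : g (iter m f y) = iter m f (g y).
  by elim: m => //= m IHm; rewrite -fgC IHm.
elim: n => [|n IHn]; first by rewrite big_nat1.
rewrite iterS IHn /= !raddf_sum [RHS]big_nat_recl //=.
under [in RHS]eq_bigr => k _ do rewrite subSS binS mulrnDr.
rewrite big_split /= addrA; congr (_ + _); last first.
  by apply: eq_bigr => k _; rewrite raddfMn giterf.
(* The top term of the ['C(n, k.+1)] half vanishes, which leaves the terms of the [f] half with
   [k > 0]. *)
rewrite [in RHS]big_nat_recr //= (bin_small (ltnSn n)) mulr0n addr0.
rewrite big_nat_recl //= !bin0 !subn0; congr (_ + _).
rewrite big_nat [RHS]big_nat; apply: eq_bigr => k /andP[_ lt_kn].
by rewrite raddfMn -(subnSK lt_kn).
Qed.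

Lemma iter_mulr_fun (A : pzRingType) (c x : A) (n : nat) :
  iter n (c \o* idfun) x = x * c ^+ n.
Proof. by elim: n => [|n IHn]; rewrite ?mulr1 //= IHn exprSr mulrA. Qed.

Section Delta.
Variables (K : pzRingType) (A : pzAlgType K).
Implicit Types (a c : A) (n m : nat).

Lemma iter_delta1 a c m :
  iter m (delta a c) 1 =
    \sum_(0 <= j < m.+1)
      ('C(m, j)%:R * (-1) ^+ j : K) *: (a ^+ (m - j) * c ^+ j).
Proof.
pose L : {additive A -> A} := a \*o idfun.
pose r : {additive A -> A} := (- c) \o* idfun.
have LrC x : L (r x) = r (L x) by exact: mulrA.
rewrite (eq_iter (_ : delta a c =1 L \+ r)); last first.
  by move=> x; rewrite /delta /= mulrN.
rewrite (iter_additiveD _ _ _ LrC); apply: eq_bigr => j _.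
rewrite iter_mulr_fun mul1r (iter_mulr _ a) (exprNn c).
rewrite -scalerA scaler_nat; congr (_ *+ _).
(* The sign lies in [A] on the left and in [K] on the right; both reduce to the parity of [j]. *)
rewrite -(signr_odd K) -(signr_odd A) scaler_sign mulr_sign.
by case: odd; rewrite ?mulrN.
Qed.

Lemma expr_sum_delta a c n :
  a ^+ n = \sum_(0 <= k < n.+1)
    ('C(n, k)%:R : K) *: (iter (n - k) (delta a c) 1 * c ^+ k).
Proof.
pose r : {additive A -> A} := c \o* idfun.
have DrC x : delta a c (r x) = r (delta a c x).
  by rewrite /delta /= mulrBl !mulrA.
(* Right multiplication by an element commuting with [c] passes through [delta a c]; used with
   [y := c ^+ k] and [x := 1]. *)
have iterMr m x y (yc : y * c = c * y) :
    iter m (delta a c) (x * y) = iter m (delta a c) x * y.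
  by elim: m => //= m ->; rewrite /delta mulrBl -!mulrA yc.
rewrite -iter_mulr_1 (eq_iter (_ : *%R a =1 delta a c \+ r)); last first.
  by move=> x; rewrite /delta /= subrK.
rewrite (iter_additiveD _ _ _ DrC); apply: eq_bigr => k _.
by rewrite iter_mulr_fun iterMr ?scaler_nat // -exprSr exprS.
Qed.

(** Gives the double sums of both parts term by term. The two powers of [c] are adjacent, so they
    merge although [a] and [c] need not commute. *)
Lemma scale_iter_delta1_mul a c n k :
  ('C(n, k)%:R : K) *: (iter (n - k) (delta a c) 1 * c ^+ k) =
    \sum_(0 <= j < (n - k).+1)
      ('C(n, k)%:R * 'C(n - k, j)%:R * (-1) ^+ j : K) *:
        (a ^+ (n - k - j) * c ^+ (j + k)).
Proof.
rewrite iter_delta1 mulr_suml scaler_sumr; apply: eq_bigr => j _.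
by rewrite -pz_scalerAl scalerA -[in RHS]mulrA exprD !mulrA.
Qed.

End Delta.

Theorem corollary2p3 (R : realType) (A : pzAlgType R[i]) (a b : A) :
  (forall n : nat, (1 <= n)%N ->
     a ^+ n - b ^+ n =
       \sum_(0 <= k < n) \sum_(0 <= j < (n - k).+1)
         ('C(n, k)%:R * 'C(n - k, j)%:R * (-1) ^+ j : R[i]) *:
           (a ^+ (n - k - j) * b ^+ (j + k)))
  /\
  (forall (c : A) (n : nat),
     (a + b) ^+ n =
       \sum_(0 <= k < n.+1)
         ('C(n, k)%:R : R[i]) *: (iter (n - k) (delta (a + b) c) 1 * c ^+ k)
     /\
     \sum_(0 <= k < n.+1)
         ('C(n, k)%:R : R[i]) *: (iter (n - k) (delta (a + b) c) 1 * c ^+ k) =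
       \sum_(0 <= k < n.+1) \sum_(0 <= j < (n - k).+1)
         ('C(n, k)%:R * 'C(n - k, j)%:R * (-1) ^+ j : R[i]) *:
           ((a + b) ^+ (n - k - j) * c ^+ (j + k))).
Proof.
split=> [n _ | c n].
  rewrite (expr_sum_delta _ A a b n) big_nat_recr //=.
  rewrite subnn binn scale1r mul1r addrK.
  by apply: eq_bigr => k _; exact: scale_iter_delta1_mul.
split; first exact: expr_sum_delta.
by apply: eq_bigr => k _; exact: scale_iter_delta1_mul.
Qed.
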